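(* Let $k\geq 3$ and $1\le t\le k-2$, and let $G$ be a graph with maximum degree $\Delta(G)\le k$ that is $t$-saturated. Then $G$ is $(1^{k-1},2)$-packing colorable.
   Context: Graphs are finite and simple; $\mathrm{dist}(x,y)$ is the usual shortest-path distance. For a non-decreasing sequence of positive integers $S=(s_1,\dots,s_p)$, an $S$-packing coloring of $G$ is a partition of $V(G)$ into sets $V_1,\dots,V_p$ such that any two distinct vertices of $V_i$ are at distance greater than $s_i$, for each $1\le i\le p$; $G$ is $S$-packing colorable if such a partition exists. The notation $i^r$ in a sequence means that $i$ is repeated $r$ times, so $(1^{k-1},2)$ is the sequence of $k-1$ ones followed by a single $2$. A vertex of degree $k$ is called a $k$-vertex. A graph $G$ with $\Delta(G)\le k$ is called $t$-saturated ($0\le t\le k$) if every $k$-vertex of $G$ is adjacent to at most $t$ vertices of degree $k$. *)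

(* Defs.v *)
From mathcomp Require Import all_boot.

Set Implicit Arguments.
Unset Strict Implicit.
Unset Printing Implicit Defensive.

Record sgraph := SGraph {
  vertex :> finType;
  adj : rel vertex;
  adj_sym : symmetric adj;
  adj_irrefl : irreflexive adj
}.

Section Graph.
Variable G : sgraph.
Implicit Types (x y : G) (n t k : nat).

Definition deg x : nat := #|[set y | adj x y]|.

Definition max_deg : nat := \max_(x : G) deg x.

(* A path with n edges lists its n + 1 pairwise distinct vertices. *)
Definition has_path x y n : bool :=
  [exists p : n.-tuple G,
     [&& path (@adj G) x p, uniq (x :: p) & last x p == y]].

Lemma connect_has_path x y : connect (@adj G) x y -> exists n, has_path x y n.
Proof.
case/connectP=> p /shortenP[q Hq Uq _ Ey]; exists (size q).
by apply/existsP; exists (in_tuple q); rewrite Hq Uq Ey eqxx.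
Qed.

(* None stands for an infinite distance (distinct connected components). *)
Definition dist x y : option nat :=
  match @idP (connect (@adj G) x y) with
  | ReflectT xy => Some (ex_minn (connect_has_path xy))
  | ReflectF _ => None
  end.

Definition dist_gt x y n : bool := if dist x y is Some d then n < d else true.

Lemma dist_SomeP x y n :
  dist x y = Some n <->
  has_path x y n /\ (forall m, has_path x y m -> n <= m).
Proof.
rewrite /dist; case: {-}_ / idP => [xy | nxy].
  case: ex_minnP => d Hd dmin; split=> [[<-] // | [Hn nmin]].
  by congr Some; apply/eqP; rewrite eqn_leq dmin ?nmin.
split=> // -[/existsP[p /and3P[Hp _ /eqP Ey]] _]; case: nxy.
by apply/connectP; exists (tval p).
Qed.

Lemma dist_NoneP x y : dist x y = None <-> (forall n, ~~ has_path x y n).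
Proof.
rewrite /dist; case: {-}_ / idP => [xy | nxy].
  by split=> // H; have [n Hn] := connect_has_path xy; case/negP: (H n).
split=> // _ n; apply/negP=> /existsP[p /and3P[Hp _ /eqP Ey]]; case: nxy.
by apply/connectP; exists (tval p).
Qed.

(* The classes are V 0, ..., V (p - 1), with V i constrained by the i-th entry
   of S (counted from 0).  As usual for colorings, classes may be empty. *)
Definition packing_coloring (S : seq nat) (V : 'I_(size S) -> {set G}) : Prop :=
  [/\ forall x, exists i, x \in V i,
      forall i j, i != j -> [disjoint V i & V j]
    & forall i x y, x \in V i -> y \in V i -> x != y ->
        dist_gt x y (nth 0 S i)].

Definition packing_colorable (S : seq nat) : Prop :=
  exists V : 'I_(size S) -> {set G}, packing_coloring V.

Definition saturated k t : Prop :=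
  forall x, deg x = k -> #|[set y | adj x y & deg y == k]| <= t.

End Graph.

(* Main.v *)
Require Import Defs.
From mathcomp Require Import all_boot.
From mathcomp Require Import zify.

Set Implicit Arguments.
Unset Strict Implicit.
Unset Printing Implicit Defensive.

(** Put [n = k - 1] and take a proper partial coloring with [n] colors that
    minimizes the total cost of its uncolored vertices, where a [k]-vertex costs
    3 and any other vertex costs 2.  An uncolored vertex sees every color, hence
    has at most one neighbor beyond one per color.  If [w] is the only neighbor
    of its color of an uncolored vertex [u], then [u] can take the color of [w]
    and [w] be uncolored; by minimality, [w] has degree [k] as soon as [u] has.
    Since a [k]-vertex has two neighbors of lower degree, no two uncolored
    vertices are adjacent.  Suppose [w], of color [i], is adjacent to two
    uncolored vertices [u] and [v].  If [w] is their only neighbor of color [i],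
    uncoloring [w] frees [i] for both, at a lower cost.  Otherwise (say) [u] has
    exactly two neighbors of color [i], [w] and [b], both of lower degree.  Then
    [w] misses some color other than [i]; giving it to [w] makes [b] the only
    neighbor of [u] of color [i], which was excluded. *)

(** * Partial colorings, recoloring and cost *)

Section PartialColoring.
Variables (G : sgraph) (n : nat).
Implicit Types (x y u v w : G) (i j : 'I_n) (o : option 'I_n)
  (c : {ffun G -> option 'I_n}).

Definition proper_partial c : bool :=
  [forall x, forall y, adj x y && (c x == c y) ==> (c x == None)].

Definition color_nbhd c x o : {set G} := [set y | adj x y & c y == o].

Definition recolor c x o : {ffun G -> option 'I_n} :=
  [ffun z => if z == x then o else c z].

(** The weights satisfy 2 < 3 < 2 + 2: moving the uncolored spot from a vertex of degree [n.+1] to a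
    lower one is a gain, and so is coloring any two vertices at the price of uncoloring one. *)
Definition vertex_cost x o : nat :=
  if o is None then 2 + (deg x == n.+1) else 0.

Definition cost c : nat := \sum_x vertex_cost x (c x).

Definition optimal c : Prop :=
  proper_partial c /\ forall c', proper_partial c' -> cost c <= cost c'.

Lemma proper_partialP c :
  reflect (forall x y, adj x y -> c x = c y -> c x = None) (proper_partial c).
Proof.
apply: (iffP forallP) => [H x y xy cxy | H x].
  by have /forallP/(_ y) := H x; rewrite xy cxy eqxx => /eqP.
by apply/forallP => y; apply/implyP => /andP[xy /eqP cxy]; rewrite (H _ y).
Qed.

Lemma recolorE c x o z : recolor c x o z = if z == x then o else c z.
Proof. by rewrite ffunE. Qed.

Lemma cost_recolor c x o :
  cost (recolor c x o) + vertex_cost x (c x) = cost c + vertex_cost x o.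
Proof.
rewrite /cost (bigD1 x) //= [\sum_z vertex_cost z (c z)](bigD1 x) //=.
rewrite recolorE eqxx.
under eq_bigr => z zx do rewrite recolorE (negbTE zx).
by lia.
Qed.

Lemma proper_uncolor c x : proper_partial c -> proper_partial (recolor c x None).
Proof.
move=> /proper_partialP pc; apply/proper_partialP => y z yz; rewrite !recolorE.
by case: eqP => // _; case: eqP => // _; exact: pc.
Qed.

Lemma proper_recolor c x i :
  proper_partial c -> (forall y, adj x y -> c y <> Some i) ->
  proper_partial (recolor c x (Some i)).
Proof.
move=> /proper_partialP pc free; apply/proper_partialP => y z yz.
rewrite !recolorE; case: eqP => [yx | _]; case: eqP => [zx | _].
- by move: yz; rewrite yx zx adj_irrefl.
- by move=> ciz; case: (free z); rewrite -?yx.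
- by move=> ciy; case: (free y); rewrite -?zx // adj_sym.
- exact: pc.
Qed.

Lemma exists_optimal : exists c, optimal c.
Proof.
have p0 : proper_partial [ffun=> None].
  by apply/proper_partialP => x y _ _; rewrite ffunE.
by case: (arg_minnP cost p0) => c pc cmin; exists c; split.
Qed.

Lemma deg_color_nbhd c x : deg x = \sum_o #|color_nbhd c x o|.
Proof.
rewrite /deg -sum1_card (partition_big c xpredT) //=.
apply: eq_bigr => o _; rewrite -sum1_card.
by apply: eq_bigl => y; rewrite !inE.
Qed.

(** Writes [n] over the same index set as [deg_color_nbhd], so that degrees can be compared with [n]
    term by term. *)
Lemma sum_colored : \sum_(o : option 'I_n) (o != None : nat) = n.
Proof.
transitivity (\sum_(o : option 'I_n | o != None) 1).
  by rewrite [RHS]big_mkcond; apply: eq_bigr => o _; case: eqP.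
by rewrite sum1_card cardC1 card_option card_ord.
Qed.

(** * Neighborhoods in an optimal coloring *)

Section Optimal.
Hypothesis degG : forall x, deg x <= n.+1.
Hypothesis low_nbhd : forall x, deg x = n.+1 ->
  1 < #|[set y | adj x y & deg y != n.+1]|.
Variable c : {ffun G -> option 'I_n}.
Hypothesis copt : optimal c.

Lemma uncolored_sees_color u i : c u = None -> 0 < #|color_nbhd c u (Some i)|.
Proof.
move=> cu; rewrite lt0n; apply/eqP => /eqP; rewrite cards_eq0 => /eqP N0.
have [pc cmin] := copt.
have /cmin : proper_partial (recolor c u (Some i)).
  apply: proper_recolor => // y uy /eqP cy.
  by have := in_set0 y; rewrite -N0 inE uy cy.
by have := cost_recolor c u (Some i); rewrite cu /=; lia.
Qed.

(** The sum is the excess over one neighbor per color; the subtraction never truncates, since every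
    color is seen. *)
Lemma uncolored_deg u : c u = None ->
  deg u = n + \sum_o (#|color_nbhd c u o| - (o != None)).
Proof.
move=> cu; rewrite (deg_color_nbhd c) -[X in _ = X + _]sum_colored -big_split /=.
apply: eq_bigr => o _; case: o => [i|] /=; last by rewrite subn0.
by rewrite subnKC // uncolored_sees_color.
Qed.

(** The degree bound leaves a total excess of at most 1, so an excess at [o] uses all of it. Here
    [o] is either a repeated color or [None], for an uncolored neighbor. *)
Lemma uncolored_excess u o : c u = None -> (o != None) < #|color_nbhd c u o| ->
  [/\ deg u = n.+1, #|color_nbhd c u o| = (o != None).+1
    & forall i, Some i != o -> #|color_nbhd c u (Some i)| = 1].
Proof.
move=> cu gto; have := uncolored_deg cu; have := degG u.
rewrite (bigD1 o) //=; move: (nat_of_bool (o != None)) gto => m gto du eu.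
split; [lia | lia | move=> i io].
move: eu; rewrite (bigD1 (Some i)) //=.
by have := uncolored_sees_color i cu; lia.
Qed.

Lemma no_low_singleton u w i : c u = None -> deg u = n.+1 ->
  color_nbhd c u (Some i) = [set w] -> deg w = n.+1.
Proof.
move=> cu du Nw; have := set11 w; rewrite -Nw inE => /andP[uw /eqP cw].
have [pc cmin] := copt; apply/eqP/negPn/negP => dw.
have /cmin : proper_partial (recolor (recolor c w None) u (Some i)).
  apply: proper_recolor; first exact: proper_uncolor.
  move=> y uy; rewrite recolorE; case: eqP => // yw cy; apply: yw.
  by apply/set1P; rewrite -Nw inE uy cy eqxx.
have uNw : u == w = false by apply/eqP => e; rewrite -e cu in cw.
have := cost_recolor (recolor c w None) u (Some i).
have := cost_recolor c w None.
by rewrite recolorE uNw cw cu /= du eqxx (negbTE dw); lia.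
Qed.

Lemma uncolored_independent u v : c u = None -> c v = None -> ~~ adj u v.
Proof.
have adjN x y : c x = None -> c y = None -> adj x y ->
    0 < #|color_nbhd c x None|.
  by move=> cx cy xy; apply/card_gt0P; exists y; rewrite inE xy cy eqxx.
move=> cu cv; apply/negP => uv.
have [du _ N1] := uncolored_excess cu (adjN _ _ cu cv uv).
have /ltnW/card_gt0P[y] := low_nbhd du.
rewrite inE => /andP[uy]; case cy: (c y) => [i|] dy.
  have /cards1P[z Nz] : #|color_nbhd c u (Some i)| == 1 by rewrite N1.
  have : y \in color_nbhd c u (Some i) by rewrite inE uy cy eqxx.
  by rewrite Nz => /set1P ez; rewrite ez (no_low_singleton cu du Nz) eqxx in dy.
(* An uncolored [y] has the uncolored neighbor [u], an excess that forces degree [n.+1]. *)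
have [||dy' _ _] := @uncolored_excess y None; rewrite ?dy' ?eqxx // in dy.
by apply: (adjN _ u); rewrite // adj_sym.
Qed.

Lemma uncolored_low_nbhd u i : c u = None ->
  1 < #|color_nbhd c u (Some i)| ->
  [/\ deg u = n.+1, #|color_nbhd c u (Some i)| = 2
    & {in color_nbhd c u (Some i), forall y, deg y != n.+1}].
Proof.
move=> cu gt1; have [du N2 N1] := uncolored_excess cu gt1; split=> // y Ny.
have sub : [set y | adj u y & deg y != n.+1] \subset color_nbhd c u (Some i).
  apply/subsetP => z; rewrite !inE => /andP[uz dz]; rewrite uz /=.
  case cz: (c z) => [j|]; last by have := uncolored_independent cu cz; rewrite uz.
  apply/negPn/negP => ji; have /eqP/cards1P[t Nt] := N1 j ji.
  have : z \in color_nbhd c u (Some j) by rewrite inE uz cz eqxx.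
  by rewrite Nt => /set1P ez; rewrite ez (no_low_singleton cu du Nt) eqxx in dz.
(* At least two low neighbors inside a class of exactly two: the sets coincide. *)
have /eqP E : [set y | adj u y & deg y != n.+1] == color_nbhd c u (Some i).
  by rewrite eqEcard sub N2 low_nbhd.
by move: Ny; rewrite -E inE => /andP[].
Qed.

(** Otherwise the [n - 1] other colors and two uncolored neighbors would give [w] degree [n.+1]. *)
Lemma missing_color w i : c w = Some i -> deg w != n.+1 ->
  1 < #|color_nbhd c w None| ->
  exists2 j, j != i & color_nbhd c w (Some j) = set0.
Proof.
move=> cw dw gt1.
case: (pickP [pred j | (j != i) && (color_nbhd c w (Some j) == set0)]) => /=.
  by move=> j /andP[ji /eqP]; exists j.
move=> nomiss; have := sum_colored; have := deg_color_nbhd c w.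
rewrite (bigD1 None) //= (bigD1 (Some i)) //= => dE.
rewrite (bigD1 None) //= (bigD1 (Some i)) //= => nE.
have le : \sum_(o | (o != None) && (o != Some i)) (o != None : nat) <=
    \sum_(o | (o != None) && (o != Some i)) #|color_nbhd c w o|.
  apply: leq_sum => -[j|] //= ji; have jNi : j != i by apply: contra ji => /eqP ->.
  by have /= := nomiss j; rewrite jNi card_gt0 /= => ->.
case/eqP: dw; apply/eqP; rewrite eqn_leq degG dE; move: nE le gt1.
by move: (bigop _ _ _) (bigop _ _ _) #|_| => a b d; lia.
Qed.

End Optimal.

(** The old and the new color of [w] both cost 0. *)
Lemma optimal_recolor c w i j : optimal c -> c w = Some i ->
  color_nbhd c w (Some j) = set0 -> optimal (recolor c w (Some j)).
Proof.
move=> [pc cmin] cw N0; split=> [|c' /cmin].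
  apply: proper_recolor => // y wy /eqP cy.
  by have := in_set0 y; rewrite -N0 inE wy cy.
by have := cost_recolor c w (Some j); rewrite cw /=; lia.
Qed.

(** * Uncolored vertices share no neighbor *)

Section Packing.
Hypothesis degG : forall x, deg x <= n.+1.
Hypothesis low_nbhd : forall x, deg x = n.+1 ->
  1 < #|[set y | adj x y & deg y != n.+1]|.

Lemma common_nbr_singleton c u v w i : optimal c ->
  c u = None -> c v = None -> u != v -> adj u w -> adj v w -> c w = Some i ->
  #|color_nbhd c u (Some i)| <= 1.
Proof.
move=> copt cu cv uv uw vw cw; rewrite leqNgt; apply/negP => gt1.
have [du N2 low] := uncolored_low_nbhd degG low_nbhd copt cu gt1.
have Nw : w \in color_nbhd c u (Some i) by rewrite inE uw cw eqxx.
have [|j ji N0] := missing_color degG cw (low w Nw).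
  by apply/card_gt1P; exists u, v; rewrite !inE !(adj_sym w) uw vw cu cv.
have copt' := optimal_recolor copt cw N0.
have /cards1P[b Nb] : #|color_nbhd c u (Some i) :\ w| == 1.
  by have := cardsD1 w (color_nbhd c u (Some i)); rewrite Nw N2 add1n => -[<-].
(* The low vertex [b] is now alone in its class around [u], against [no_low_singleton] for the new
   optimal coloring. *)
have Nb' : color_nbhd (recolor c w (Some j)) u (Some i) = [set b].
  rewrite -Nb; apply/setP => y; rewrite !inE recolorE.
  by case: (y =P w) => //= _; rewrite (inj_eq Some_inj) (negbTE ji) andbF.
have := set11 b; rewrite -Nb => /setD1P[_ /low/eqP]; apply.
apply: (no_low_singleton copt' _ du Nb').
by rewrite recolorE; case: eqP => // e; rewrite -e cu in cw.
Qed.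

Lemma uncolored_no_common_nbr c u v w : optimal c ->
  c u = None -> c v = None -> u != v -> adj u w -> adj v w -> False.
Proof.
move=> copt cu cv uv uw vw.
have nadj := uncolored_independent degG low_nbhd copt.
case cw: (c w) => [i|]; last by have := nadj u w cu cw; rewrite uw.
have only x : c x = None -> #|color_nbhd c x (Some i)| <= 1 -> adj x w ->
    forall y, adj x y -> c y = Some i -> y = w.
  move=> cx /card_le1_eqP le1 xw y xy cy.
  by apply: le1; rewrite inE ?xw ?xy ?cy ?cw eqxx.
have onlyu := only u cu (common_nbr_singleton copt cu cv uv uw vw cw) uw.
have vu : v != u by rewrite eq_sym.
have onlyv := only v cv (common_nbr_singleton copt cv cu vu vw uw cw) vw.
have [pc cmin] := copt.
have uNw : u == w = false by apply/eqP => e; rewrite -e cu in cw.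
have vNw : v == w = false by apply/eqP => e; rewrite -e cv in cw.
(* Uncoloring [w] costs at most 3, while coloring [u] and [v] saves at least 4. *)
pose c1 := recolor c w None; pose c2 := recolor c1 u (Some i).
have /cmin : proper_partial (recolor c2 v (Some i)).
  apply: proper_recolor.
    apply: proper_recolor; first exact: proper_uncolor.
    by move=> y uy; rewrite recolorE; case: eqP => // yw /(onlyu y uy).
  move=> y vy; rewrite !recolorE; case: eqP => [yu|_].
    by have := nadj v u cv cu; rewrite -yu vy.
  by case: eqP => // yw /(onlyv y vy).
have := cost_recolor c2 v (Some i); have := cost_recolor c1 u (Some i).
have := cost_recolor c w None.
rewrite -/c1 -/c2 /c2 /c1 !recolorE (negbTE vu) uNw vNw cu cv cw /=.
by case: (deg w == _); lia.
Qed.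

End Packing.
End PartialColoring.

(** * From partial colorings to packing colorings *)

Lemma dist_gt1 (G : sgraph) (x y : G) : x != y -> ~~ adj x y -> dist_gt x y 1.
Proof.
move=> xy nxy; rewrite /dist_gt; case E: (dist x y) => [d|] //.
have [/existsP[p /and3P[pp _ /eqP lp]] _] := (dist_SomeP _ _ _).1 E.
case: p pp lp => -[|a [|b p]] /= /eqP <- //=.
  by move=> _ e; rewrite e eqxx in xy.
by rewrite andbT => xa e; rewrite -e xa in nxy.
Qed.

Lemma dist_gt2 (G : sgraph) (x y : G) : x != y -> ~~ adj x y ->
  (forall w, adj x w -> adj y w -> False) -> dist_gt x y 2.
Proof.
move=> xy nxy ncom; rewrite /dist_gt; case E: (dist x y) => [d|] //.
have [/existsP[p /and3P[pp _ /eqP lp]] _] := (dist_SomeP _ _ _).1 E.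
case: p pp lp => -[|a [|b [|z p]]] /= /eqP <- //=.
- by move=> _ e; rewrite e eqxx in xy.
- by rewrite andbT => xa e; rewrite -e xa in nxy.
- by rewrite andbT => /andP[xa ab] e; case: (ncom a); rewrite // -e adj_sym.
Qed.

Lemma packing_colorable_of_partial (G : sgraph) (n : nat)
    (c : {ffun G -> option 'I_n}) :
  proper_partial c ->
  (forall x y, c x = None -> c y = None -> x != y -> dist_gt x y 2) ->
  packing_colorable G (rcons (nseq n 1) 2).
Proof.
move=> /proper_partialP pc far.
(* Counting from 0, entry [n] of the sequence is the 2, so the uncolored vertices form the last
   class. *)
pose col x : nat := if c x is Some j then j else n.
have sz : size (rcons (nseq n 1) 2) = n.+1 by rewrite size_rcons size_nseq.
exists (fun i : 'I_(size _) => [set x | col x == i]); split=> [x|i j ij|i x y].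
- have lt : col x < size (rcons (nseq n 1) 2).
    by rewrite sz /col; case: (c x) => // j; rewrite ltnW ?ltnS.
  by exists (Ordinal lt); rewrite inE.
- rewrite -setI_eq0; apply/eqP/setP => x; rewrite !inE.
  by apply/negP => /andP[/eqP-> /eqP/val_inj e]; rewrite e eqxx in ij.
rewrite !inE nth_rcons size_nseq => /eqP <- /eqP; rewrite /col.
case cx: (c x) => [a|]; case cy: (c y) => [b|].
- move=> /val_inj ba xy; rewrite ltn_ord nth_nseq ltn_ord; apply: dist_gt1 => //.
  by apply/negP => xy'; have := pc x y xy'; rewrite cx cy ba => /(_ erefl).
- by move=> e; have := ltn_ord a; rewrite -e ltnn.
- by move=> e; have := ltn_ord b; rewrite e ltnn.
- by move=> _ xy; rewrite ltnn eqxx; apply: far.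
Qed.

Theorem theorem3p1 (k t : nat) (G : sgraph) :
  3 <= k -> 1 <= t <= k - 2 ->
  max_deg G <= k -> saturated G k t ->
  packing_colorable G (rcons (nseq (k - 1) 1) 2).
Proof.
case: k => [//|n] k3 /andP[_ tn] dmax sat; rewrite subn1 /=.
have degG (x : G) : deg x <= n.+1 by apply: leq_trans dmax; apply: leq_bigmax.
have low_nbhd (x : G) : deg x = n.+1 ->
    1 < #|[set y | adj x y & deg y != n.+1]|.
  (* Of the [n.+1] neighbors at most [t <= n - 1] have degree [n.+1], which leaves two. *)
  move=> dx; have := sat x dx.
  have := cardsID [set y : G | deg y == n.+1] [set y | adj x y].
  rewrite -[#|[set y | adj x y]|]/(deg x) dx.
  have -> : [set y | adj x y] :&: [set y : G | deg y == n.+1] =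
            [set y | adj x y & deg y == n.+1] by apply/setP => y; rewrite !inE.
  have -> : [set y | adj x y] :\: [set y : G | deg y == n.+1] =
            [set y | adj x y & deg y != n.+1].
    by apply/setP => y; rewrite !inE andbC.
  by lia.
have [c copt] := exists_optimal G n; case: (copt) => pc _.
apply: (packing_colorable_of_partial pc) => x y cx cy xy; apply: dist_gt2 => //.
  exact: uncolored_independent degG low_nbhd _ copt _ _ cx cy.
by move=> w; apply: uncolored_no_common_nbr degG low_nbhd _ _ _ _ copt cx cy xy.
Qed.
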